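(* Let $M$ be a multigraph and let $A$ be a vertex of $M$. Then there is a unique braided strict monoidal functor $$\mathbf{Tangle}\to\mathbf{TCircD}_M$$ taking the generating object $X$ of $\mathbf{Tangle}$ to $A$ and the structure maps $\eta:I\to X\otimes X$, $\epsilon:X\otimes X\to I$ of $X$ to the corresponding structure maps $\eta_A=\Delta_A n_A$ and $\epsilon_A=e_A\nabla_A$ of $A$ in $\mathbf{TCircD}_M$.
   Context: Composition is written right to left. Braided strict monoidal category: a category $\mathbf{C}$ with a functor $\otimes:\mathbf{C}\times\mathbf{C}\to\mathbf{C}$, strictly associative and strictly unital with unit object $I$, and a natural family of isomorphisms $\tau_{A,B}:A\otimes B\to B\otimes A$ (the twist) such that $\tau_{A,B\otimes C}=(1_B\otimes\tau_{A,C})(\tau_{A,B}\otimes 1_C)$ and $\tau_{A\otimes B,C}=(\tau_{A,C}\otimes 1_B)(1_A\otimes\tau_{B,C})$. A braided strict monoidal functor preserves $\otimes$, $I$ and $\tau$ strictly. Commutative Frobenius algebra: an object $G$ with arrows $\nabla:G\otimes G\to G$, $\Delta:G\to G\otimes G$, $n:I\to G$, $e:G\to I$ such that $(G,\nabla,n)$ is a monoid, $(G,\Delta,e)$ is a comonoid, $(1_G\otimes\nabla)(\Delta\otimes 1_G)=\Delta\nabla=(\nabla\otimes 1_G)(1_G\otimes\Delta)$, $\nabla\tau_{G,G}=\nabla$ and $\tau_{G,G}\Delta=\Delta$. Tangle algebra: an object $X$ with arrows $\eta:I\to X\otimes X$ and $\epsilon:X\otimes X\to I$ such that $(\epsilon\otimes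 1)(1\otimes\eta)=1=(1\otimes\epsilon)(\eta\otimes 1)$, $\epsilon\tau=\epsilon$ and $\tau\eta=\eta$. $\mathbf{Tangle}$ is the free braided strict monoidal category generated by one object $X$ equipped with a tangle algebra structure $(\eta,\epsilon)$. A multigraph $M$ consists of a set $M_0$ (vertices), a set $M_1$ (edges), and two functions $dom,cod:M_1\to M_0^*$, where $M_0^*$ is the free monoid on $M_0$. $\mathbf{TCircD}_M$ is the free braided strict monoidal category generated by $M$ in which each vertex $A\in M_0$ is equipped with a commutative Frobenius algebra structure $(\nabla_A,\Delta_A,n_A,e_A)$: its generating objects are the vertices of $M$, its generating arrows are the edges of $M$ (an edge $f$ being an arrow from the tensor product of the word $dom(f)$ to that of $cod(f)$, the empty word giving $I$) together with the Frobenius structure maps, subject only to the axioms of braided strict monoidal categories and of commutative Frobenius algebras. *)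

(* Defs.v *)
From HB Require Import structures.
From mathcomp Require Import all_boot.
From mathcomp Require Import generic_quotient boolp.

Set Implicit Arguments.
Unset Strict Implicit.
Unset Printing Implicit Defensive.

Reserved Notation "g ∘ f" (at level 40, left associativity).
Reserved Notation "f ⊗ g" (at level 38, left associativity).
Reserved Notation "a ⊗o b" (at level 38, left associativity).

Local Open Scope quotient_scope.

Declare Scope bsm_scope.
Delimit Scope bsm_scope with bsm.
Declare Scope term_scope.
Delimit Scope term_scope with term.

(* Categories are presented by one set of objects and one set of arrows with
   source and target maps, so that the equations of a strict monoidal structure
   are plain equations between arrows, with no transport along equalities of
   objects. Composition is written right to left. It is a total function, but
   [compA g f] is meaningful only when [src g = tgt f]: no law below, and no
   condition on functors, constrains its value otherwise. *)
Record bsm_data := BsmData {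
  ob : Type;
  arr : Type;
  src : arr -> ob;
  tgt : arr -> ob;
  idn : ob -> arr;
  compA : arr -> arr -> arr;
  unitO : ob;
  tensO : ob -> ob -> ob;
  tensA : arr -> arr -> arr;
  braid : ob -> ob -> arr
}.

Arguments unitO : clear implicits.

Notation "g ∘ f" := (compA g f) : bsm_scope.
Notation "a ⊗o b" := (tensO a b) : bsm_scope.
Notation "f ⊗ g" := (tensA f g) : bsm_scope.

Section Laws.
Local Open Scope bsm_scope.

Record is_category (C : bsm_data) : Prop := {
  src_idn : forall a : ob C, src (idn a) = a;
  tgt_idn : forall a : ob C, tgt (idn a) = a;
  src_comp : forall g f : arr C, src g = tgt f -> src (g ∘ f) = src f;
  tgt_comp : forall g f : arr C, src g = tgt f -> tgt (g ∘ f) = tgt g;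
  comp_idl : forall f : arr C, idn (tgt f) ∘ f = f;
  comp_idr : forall f : arr C, f ∘ idn (src f) = f;
  comp_assoc : forall h g f : arr C, src h = tgt g -> src g = tgt f ->
    h ∘ (g ∘ f) = (h ∘ g) ∘ f
}.

Record is_strict_monoidal (C : bsm_data) : Prop := {
  src_tens : forall f g : arr C, src (f ⊗ g) = src f ⊗o src g;
  tgt_tens : forall f g : arr C, tgt (f ⊗ g) = tgt f ⊗o tgt g;
  tens_idn : forall a b : ob C, idn a ⊗ idn b = idn (a ⊗o b);
  tens_comp : forall g f k h : arr C, src g = tgt f -> src k = tgt h ->
    (g ∘ f) ⊗ (k ∘ h) = (g ⊗ k) ∘ (f ⊗ h);
  tensO_assoc : forall a b c : ob C, a ⊗o (b ⊗o c) = (a ⊗o b) ⊗o c;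
  tensO_unitl : forall a : ob C, unitO C ⊗o a = a;
  tensO_unitr : forall a : ob C, a ⊗o unitO C = a;
  tensA_assoc : forall f g h : arr C, f ⊗ (g ⊗ h) = (f ⊗ g) ⊗ h;
  tensA_unitl : forall f : arr C, idn (unitO C) ⊗ f = f;
  tensA_unitr : forall f : arr C, f ⊗ idn (unitO C) = f
}.

Definition is_iso (C : bsm_data) (f : arr C) : Prop :=
  exists g : arr C, [/\ src g = tgt f, tgt g = src f,
    g ∘ f = idn (src f) & f ∘ g = idn (tgt f)].

Record is_braided (C : bsm_data) : Prop := {
  src_braid : forall a b : ob C, src (braid a b) = a ⊗o b;
  tgt_braid : forall a b : ob C, tgt (braid a b) = b ⊗o a;
  braid_iso : forall a b : ob C, is_iso (braid a b);
  braid_nat : forall f g : arr C,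
    braid (tgt f) (tgt g) ∘ (f ⊗ g) = (g ⊗ f) ∘ braid (src f) (src g);
  braid_tensr : forall a b c : ob C,
    braid a (b ⊗o c) = (idn b ⊗ braid a c) ∘ (braid a b ⊗ idn c);
  braid_tensl : forall a b c : ob C,
    braid (a ⊗o b) c = (braid a c ⊗ idn b) ∘ (idn a ⊗ braid b c)
}.

Record bsm_category := BsmCategory {
  bsm_sort :> bsm_data;
  bsm_category_ax : is_category bsm_sort;
  bsm_monoidal_ax : is_strict_monoidal bsm_sort;
  bsm_braided_ax : is_braided bsm_sort
}.

Record bsm_functor (C D : bsm_category) := BsmFunctor {
  fob : ob C -> ob D;
  farr : arr C -> arr D;
  f_src : forall f, src (farr f) = fob (src f);
  f_tgt : forall f, tgt (farr f) = fob (tgt f);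
  f_idn : forall a, farr (idn a) = idn (fob a);
  f_comp : forall g f, src g = tgt f -> farr (g ∘ f) = farr g ∘ farr f;
  f_unitO : fob (unitO C) = unitO D;
  f_tensO : forall a b, fob (a ⊗o b) = fob a ⊗o fob b;
  f_tensA : forall f g, farr (f ⊗ g) = farr f ⊗ farr g;
  f_braid : forall a b, farr (braid a b) = braid (fob a) (fob b)
}.

End Laws.

Record multigraph := Multigraph {
  vertex : Type;
  edge : Type;
  dom : edge -> seq vertex;
  cod : edge -> seq vertex
}.

Inductive term (N : multigraph) : Type :=
| Gen of edge N
| Id of seq (vertex N)
| Comp of term N & term N
| Tens of term N & term N
| Braid of seq (vertex N) & seq (vertex N)
| BraidInv of seq (vertex N) & seq (vertex N).

Arguments Gen {N}.
Arguments Id {N}.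
Arguments Braid {N}.
Arguments BraidInv {N}.

Notation "g ∘ f" := (Comp g f) : term_scope.
Notation "f ⊗ g" := (Tens f g) : term_scope.

Section Terms.
Variable N : multigraph.
Local Open Scope term_scope.

Fixpoint tdom (t : term N) : seq (vertex N) :=
  match t with
  | Gen f => dom f
  | Id u => u
  | g ∘ f => tdom f
  | f ⊗ g => tdom f ++ tdom g
  | Braid u v => u ++ v
  | BraidInv u v => v ++ u
  end.

Fixpoint tcod (t : term N) : seq (vertex N) :=
  match t with
  | Gen f => cod f
  | Id u => u
  | g ∘ f => tcod g
  | f ⊗ g => tcod f ++ tcod g
  | Braid u v => v ++ u
  | BraidInv u v => u ++ v
  end.

Fixpoint wf (t : term N) : Prop :=
  match t with
  | g ∘ f => [/\ wf g, wf f & tdom g = tcod f]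
  | f ⊗ g => wf f /\ wf g
  | _ => True
  end.

Definition parallel (t u : term N) : Prop :=
  [/\ wf t, wf u, tdom t = tdom u & tcod t = tcod u].

End Terms.

Record presentation := Presentation {
  pgraph : multigraph;
  prel : term pgraph -> term pgraph -> Prop;
  prel_parallel : forall t u, prel t u -> parallel t u
}.

Section Free.
Variable P : presentation.
Local Notation N := (pgraph P).

(* The braided monoidal congruence generated by [prel P]. Both sides of each
   clause have the same domain and codomain, and one is well formed if and only
   if the other is; interchange is the only axiom that needs a side condition
   for this. *)
Inductive teq : term N -> term N -> Prop :=
| teq_refl t : teq t t
| teq_sym t u : teq t u -> teq u t
| teq_trans t u v : teq t u -> teq u v -> teq t v
| teq_comp g g' f f' : teq g g' -> teq f f' -> teq (g ∘ f)%term (g' ∘ f')%term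
| teq_tens f f' g g' : teq f f' -> teq g g' -> teq (f ⊗ g)%term (f' ⊗ g')%term
| teq_rel t u : prel t u -> teq t u
| teq_idl f : teq (Id (tcod f) ∘ f)%term f
| teq_idr f : teq (f ∘ Id (tdom f))%term f
| teq_assoc h g f : teq (h ∘ (g ∘ f))%term ((h ∘ g) ∘ f)%term
| teq_tens_id u v : teq (Id u ⊗ Id v)%term (Id (u ++ v))
| teq_interchange g f k h : tdom g = tcod f -> tdom k = tcod h ->
    teq ((g ∘ f) ⊗ (k ∘ h))%term ((g ⊗ k) ∘ (f ⊗ h))%term
| teq_tensA f g h : teq (f ⊗ (g ⊗ h))%term ((f ⊗ g) ⊗ h)%term
| teq_unitl f : teq (Id [::] ⊗ f)%term f
| teq_unitr f : teq (f ⊗ Id [::])%term f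
| teq_braidK u v : teq (BraidInv u v ∘ Braid u v)%term (Id (u ++ v))
| teq_braidVK u v : teq (Braid u v ∘ BraidInv u v)%term (Id (v ++ u))
| teq_braid_nat f g : teq (Braid (tcod f) (tcod g) ∘ (f ⊗ g))%term
                          ((g ⊗ f) ∘ Braid (tdom f) (tdom g))%term
| teq_braid_tensr u v w : teq (Braid u (v ++ w))
    ((Id v ⊗ Braid u w) ∘ (Braid u v ⊗ Id w))%term
| teq_braid_tensl u v w : teq (Braid (u ++ v) w)
    ((Braid u w ⊗ Id v) ∘ (Id u ⊗ Braid v w))%term.

Lemma teq_inv t u : teq t u ->
  [/\ tdom t = tdom u, tcod t = tcod u & (wf t <-> wf u)].
Proof.
elim=> {t u} /=.
- by [].
- by move=> t u _ [-> -> e]; split=> //; split=> /e.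
- by move=> t u v _ [-> -> e] _ [-> -> e']; split=> //; split=> [/e/e'|/e'/e].
- move=> g g' f f' _ [dg cg wg] _ [df cf wf']; split=> //.
  by rewrite dg cf; split=> -[/wg ? /wf' ? ?].
- move=> f f' g g' _ [df cf wf'] _ [dg cg wg]; rewrite df cf dg cg; split=> //.
  by split=> -[/wf' ? /wg ?].
- by move=> t u /prel_parallel[].
- by move=> f; split=> //; split=> [[]|].
- by move=> f; split=> //; split=> [[]|].
- by move=> h g f; split=> //; split=> [[? [? ? ?] ?]|[[? ? ?] ? ?]].
- by [].
- by move=> g f k h e1 e2; split=> //; rewrite e1 e2; split=> [[[? ? ?] [? ? ?]]|[[? ?] [? ?] ?]].
- by move=> f g h; rewrite !catA; split=> //; split=> [[? [? ?]]|[[? ?] ?]].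
- by move=> f; split=> //; split=> [[]|].
- by move=> f; rewrite !cats0; split=> //; split=> [[]|].
- by [].
- by [].
- by move=> f g; split=> //; split=> [[_ [? ?] _]|[[? ?] _ _]].
- by move=> u v w; rewrite -!catA.
- by move=> u v w; rewrite -!catA.
Qed.

Record wterm := WTerm { wterm_val :> term N; wterm_wf : wf wterm_val }.

HB.instance Definition _ := gen_eqMixin wterm.
HB.instance Definition _ := gen_choiceMixin wterm.

Definition weq (t u : wterm) : bool := `[< teq t u >].

Lemma weq_refl : reflexive weq.
Proof. by move=> t; apply/asboolP; apply: teq_refl. Qed.

Lemma weq_sym : symmetric weq.
Proof. by move=> t u; apply/asboolP/asboolP; apply: teq_sym. Qed.

Lemma weq_trans : transitive weq.
Proof.
by move=> t u v /asboolP tu /asboolP uv; apply/asboolP; apply: teq_trans uv.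
Qed.

Canonical weq_equiv := EquivRel weq weq_refl weq_sym weq_trans.

Definition free_arr : Type := {eq_quot weq_equiv}.

(* The class of a term; the identity of the empty word when [t] is ill formed. *)
Definition cls (t : term N) : free_arr :=
  match pselect (wf t) with
  | left h => \pi_({eq_quot weq_equiv}) (WTerm h)
  | right _ => \pi_({eq_quot weq_equiv}) (@WTerm (Id [::]) I)
  end.

Definition rep (f : free_arr) : term N := repr (f : {eq_quot weq_equiv}).

Lemma rep_wf f : wf (rep f).
Proof. exact: wterm_wf. Qed.

Lemma cls_rep f : cls (rep f) = f.
Proof.
rewrite /cls; case: pselect => [h|/(_ (rep_wf f))//].
rewrite -[RHS]reprK; congr (\pi _); rewrite /rep in h *.
by case: (repr _) h => //= t h h'; congr WTerm; apply: Prop_irrelevance.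
Qed.

Lemma cls_eq t u : wf t -> wf u -> (cls t = cls u) <-> teq t u.
Proof.
move=> ht hu; rewrite /cls; case: pselect => // h; case: pselect => // h'.
by split=> [/eqmodP/asboolP //|e]; apply/eqmodP/asboolP.
Qed.

Lemma rep_cls t : wf t -> teq (rep (cls t)) t.
Proof. by move=> ht; apply/cls_eq => //; [apply: rep_wf|rewrite cls_rep]. Qed.

Definition free_data : bsm_data := {|
  ob := seq (vertex N);
  arr := free_arr;
  src := fun f => tdom (rep f);
  tgt := fun f => tcod (rep f);
  idn := fun u => cls (Id u);
  compA := fun g f => cls (rep g ∘ rep f)%term;
  unitO := [::];
  tensO := cat;
  tensA := fun f g => cls (rep f ⊗ rep g)%term;
  braid := fun u v => cls (Braid u v)
|}.

Definition gen (f : edge N) : arr free_data := cls (Gen f).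

Lemma src_cls t : wf t -> @src free_data (cls t) = tdom t.
Proof. by move=> /rep_cls/teq_inv[]. Qed.

Lemma tgt_cls t : wf t -> @tgt free_data (cls t) = tcod t.
Proof. by move=> /rep_cls/teq_inv[]. Qed.

Lemma cls_comp g f : wf g -> wf f -> tdom g = tcod f ->
  @compA free_data (cls g) (cls f) = cls (g ∘ f)%term.
Proof.
move=> hg hf e; apply/cls_eq.
- split; [exact: rep_wf|exact: rep_wf|].
  by move: (src_cls hg) (tgt_cls hf) => /= -> ->.
- by split.
- by apply: teq_comp; apply: rep_cls.
Qed.

Lemma cls_tens f g : wf f -> wf g ->
  @tensA free_data (cls f) (cls g) = cls (f ⊗ g)%term.
Proof.
move=> hf hg; apply/cls_eq.
- by split; apply: rep_wf.
- by split.
- by apply: teq_tens; apply: rep_cls.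
Qed.

Lemma clsP (f : arr free_data) : exists2 t, wf t & f = cls t.
Proof. by exists (rep f); [apply: rep_wf|rewrite cls_rep]. Qed.

Lemma cls_idn u : @idn free_data u = cls (Id u).
Proof. by []. Qed.

Lemma cls_braid u v : @braid free_data u v = cls (Braid u v).
Proof. by []. Qed.

Lemma free_category_ax : is_category free_data.
Proof.
split.
- by move=> a; rewrite cls_idn src_cls.
- by move=> a; rewrite cls_idn tgt_cls.
- move=> g f; have [t wt ->] := clsP g; have [u wu ->] := clsP f.
  rewrite (src_cls wt) (tgt_cls wu) => e.
  by rewrite cls_comp // !src_cls.
- move=> g f; have [t wt ->] := clsP g; have [u wu ->] := clsP f.
  rewrite (src_cls wt) (tgt_cls wu) => e.
  by rewrite cls_comp // !tgt_cls.
- move=> f; have [t wt ->] := clsP f; rewrite tgt_cls // cls_idn cls_comp //.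
  by apply/cls_eq => //; apply: teq_idl.
- move=> f; have [t wt ->] := clsP f; rewrite src_cls // cls_idn cls_comp //.
  by apply/cls_eq => //; apply: teq_idr.
- move=> h g f; have [s ws ->] := clsP h; have [t wt ->] := clsP g.
  have [u wu ->] := clsP f.
  rewrite !(src_cls, tgt_cls) // => e1 e2; rewrite !cls_comp //.
  by apply/cls_eq => //; apply: teq_assoc.
Qed.

Lemma free_monoidal_ax : is_strict_monoidal free_data.
Proof.
split.
- move=> f g; have [t wt ->] := clsP f; have [u wu ->] := clsP g.
  by rewrite cls_tens // !src_cls.
- move=> f g; have [t wt ->] := clsP f; have [u wu ->] := clsP g.
  by rewrite cls_tens // !tgt_cls.
- move=> u v; rewrite !cls_idn cls_tens //.
  by apply/cls_eq => //; apply: teq_tens_id.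
- move=> g f k h; have [t wt ->] := clsP g; have [u wu ->] := clsP f.
  have [t' wt' ->] := clsP k; have [u' wu' ->] := clsP h.
  rewrite !(src_cls, tgt_cls) // => e1 e2.
  have e : tdom (t ⊗ t')%term = tcod (u ⊗ u')%term by rewrite /= e1 e2.
  rewrite (cls_comp wt wu e1) (cls_comp wt' wu' e2) !cls_tens // cls_comp //.
  by apply/cls_eq => //; apply: teq_interchange.
- exact: catA.
- by [].
- exact: cats0.
- move=> f g h; have [s ws ->] := clsP f; have [t wt ->] := clsP g.
  have [u wu ->] := clsP h; rewrite !cls_tens //.
  by apply/cls_eq => //; apply: teq_tensA.
- move=> f; have [t wt ->] := clsP f; rewrite cls_idn cls_tens //.
  by apply/cls_eq => //; apply: teq_unitl.
- move=> f; have [t wt ->] := clsP f; rewrite cls_idn cls_tens //.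
  by apply/cls_eq => //; apply: teq_unitr.
Qed.

Lemma free_braided_ax : is_braided free_data.
Proof.
split.
- by move=> u v; rewrite cls_braid src_cls.
- by move=> u v; rewrite cls_braid tgt_cls.
- move=> u v; exists (cls (BraidInv u v)).
  rewrite cls_braid !(src_cls, tgt_cls) // !cls_idn !cls_comp //.
  split=> //; apply/cls_eq => //; [exact: teq_braidK|exact: teq_braidVK].
- move=> f g; have [t wt ->] := clsP f; have [u wu ->] := clsP g.
  rewrite !(src_cls, tgt_cls) // !cls_braid !cls_tens // !cls_comp //.
  by apply/cls_eq => //; apply: teq_braid_nat.
- move=> u v w; have e : v ++ (u ++ w) = (v ++ u) ++ w by rewrite catA.
  rewrite !cls_braid !cls_idn !cls_tens // cls_comp //.
  by apply/cls_eq => //; apply: teq_braid_tensr.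
- move=> u v w; have e : (u ++ w) ++ v = u ++ (w ++ v) by rewrite catA.
  rewrite !cls_braid !cls_idn !cls_tens // cls_comp //.
  by apply/cls_eq => //; apply: teq_braid_tensl.
Qed.

Definition free_bsm : bsm_category :=
  BsmCategory free_category_ax free_monoidal_ax free_braided_ax.

End Free.

Inductive tangle_edge := Cup | Cap.

Definition tangle_graph : multigraph := {|
  vertex := unit;
  edge := tangle_edge;
  dom := fun f => if f is Cup then [::] else [:: tt; tt];
  cod := fun f => if f is Cup then [:: tt; tt] else [::]
|}.

Section TangleRel.
Local Open Scope term_scope.
Let X : seq (vertex tangle_graph) := [:: tt].
Let one : term tangle_graph := Id X.
Let eta : term tangle_graph := @Gen tangle_graph Cup.
Let eps : term tangle_graph := @Gen tangle_graph Cap.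
Let tau : term tangle_graph := Braid X X.

Inductive tangle_rel : term tangle_graph -> term tangle_graph -> Prop :=
| tangle_snakel : tangle_rel ((eps ⊗ one) ∘ (one ⊗ eta)) one
| tangle_snaker : tangle_rel ((one ⊗ eps) ∘ (eta ⊗ one)) one
| tangle_cap_comm : tangle_rel (eps ∘ tau) eps
| tangle_cup_comm : tangle_rel (tau ∘ eta) eta.

Lemma tangle_rel_parallel t u : tangle_rel t u -> parallel t u.
Proof. by case. Qed.

End TangleRel.

Definition Tangle : bsm_category := free_bsm (Presentation tangle_rel_parallel).

Definition tangle_X : ob Tangle := [:: tt].
Definition tangle_eta : arr Tangle := @gen (Presentation tangle_rel_parallel) Cup.
Definition tangle_eps : arr Tangle := @gen (Presentation tangle_rel_parallel) Cap.

Section TCircD.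
Variable M : multigraph.

Inductive tcircd_edge :=
| MEdge of edge M
| Mul of vertex M
| Comul of vertex M
| Unit of vertex M
| Counit of vertex M.

Definition tcircd_graph : multigraph := {|
  vertex := vertex M;
  edge := tcircd_edge;
  dom := fun f => match f with
    | MEdge f => dom f
    | Mul A => [:: A; A]
    | Comul A => [:: A]
    | Unit A => [::]
    | Counit A => [:: A]
    end;
  cod := fun f => match f with
    | MEdge f => cod f
    | Mul A => [:: A]
    | Comul A => [:: A; A]
    | Unit A => [:: A]
    | Counit A => [::]
    end
|}.

Section FrobRel.
Local Open Scope term_scope.
Let one (A : vertex M) : term tcircd_graph := @Id tcircd_graph [:: A].
Let mul (A : vertex M) : term tcircd_graph := @Gen tcircd_graph (Mul A).
Let comul (A : vertex M) : term tcircd_graph := @Gen tcircd_graph (Comul A).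
Let n (A : vertex M) : term tcircd_graph := @Gen tcircd_graph (Unit A).
Let e (A : vertex M) : term tcircd_graph := @Gen tcircd_graph (Counit A).
Let tau (A : vertex M) : term tcircd_graph := @Braid tcircd_graph [:: A] [:: A].

Inductive frobenius_rel : term tcircd_graph -> term tcircd_graph -> Prop :=
| frob_mulA A : frobenius_rel (mul A ∘ (mul A ⊗ one A)) (mul A ∘ (one A ⊗ mul A))
| frob_mul_unitl A : frobenius_rel (mul A ∘ (n A ⊗ one A)) (one A)
| frob_mul_unitr A : frobenius_rel (mul A ∘ (one A ⊗ n A)) (one A)
| frob_comulA A :
    frobenius_rel ((comul A ⊗ one A) ∘ comul A) ((one A ⊗ comul A) ∘ comul A)
| frob_comul_counitl A : frobenius_rel ((e A ⊗ one A) ∘ comul A) (one A)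
| frob_comul_counitr A : frobenius_rel ((one A ⊗ e A) ∘ comul A) (one A)
| frob_frobl A :
    frobenius_rel ((one A ⊗ mul A) ∘ (comul A ⊗ one A)) (comul A ∘ mul A)
| frob_frobr A :
    frobenius_rel ((mul A ⊗ one A) ∘ (one A ⊗ comul A)) (comul A ∘ mul A)
| frob_mul_comm A : frobenius_rel (mul A ∘ tau A) (mul A)
| frob_comul_comm A : frobenius_rel (tau A ∘ comul A) (comul A).

Lemma frobenius_rel_parallel t u : frobenius_rel t u -> parallel t u.
Proof. by case. Qed.

End FrobRel.

Definition tcircd_pres : presentation := Presentation frobenius_rel_parallel.

Definition TCircD : bsm_category := free_bsm tcircd_pres.

Definition tcircd_ob (A : vertex M) : ob TCircD := [:: A].
Definition nabla (A : vertex M) : arr TCircD := @gen tcircd_pres (Mul A).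
Definition Delta (A : vertex M) : arr TCircD := @gen tcircd_pres (Comul A).
Definition frob_unit (A : vertex M) : arr TCircD := @gen tcircd_pres (Unit A).
Definition frob_counit (A : vertex M) : arr TCircD := @gen tcircd_pres (Counit A).

End TCircD.

(* Main.v *)
Require Import Defs.
From mathcomp Require Import all_boot.
From mathcomp Require Import boolp.

Set Implicit Arguments.
Unset Strict Implicit.
Unset Printing Implicit Defensive.

(** A functor out of a freely generated category is the same thing as an
    assignment of the generators respecting the relations, so it suffices to
    check the tangle axioms for [Δn] and [e∇]. By the Frobenius law, the snake
    [(e∇ ⊗ 1)(1 ⊗ Δn)] equals [(e ⊗ 1)Δ∇(1 ⊗ n)], which is the identity by the
    unit and counit laws, and symmetrically for the other snake; the two
    symmetry axioms are those of [∇] and [Δ]. *)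

(** A left inverse equals a right inverse: [g = g (f g') = (g f) g' = g']. The typing hypotheses are
    what license associativity, since composition is total. *)
Lemma inverse_unique (C : bsm_category) (f g g' : arr C) :
  src g = tgt f -> src g' = tgt f -> tgt g' = src f ->
  (g ∘ f)%bsm = idn (src f) -> (f ∘ g')%bsm = idn (tgt f) -> g = g'.
Proof.
move=> sg sg' tg' gf fg'; have ax := bsm_category_ax C.
by rewrite -(comp_idr ax g) sg -fg' comp_assoc // gf -tg' comp_idl.
Qed.

(** The remaining fields are proofs of propositions, so proof irrelevance identifies them. *)
Lemma bsm_functor_eq (C D : bsm_category) (F G : bsm_functor C D) :
  fob F =1 fob G -> farr F =1 farr G -> F = G.
Proof.
case: F => fo fa ? ? ? ? ? ? ? ?; case: G => go ga ? ? ? ? ? ? ? ? /=.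
by move=> /funext eo /funext ea; subst go ga; congr BsmFunctor;
  apply: Prop_irrelevance.
Qed.

(** * Functors out of a free category are determined by the generators *)

Section FreeFunctorUnique.
Variables (P : presentation) (D : bsm_category).
Variables (F G : bsm_functor (free_bsm P) D).
Hypothesis eq_vertex : forall x, fob F [:: x] = fob G [:: x].
Hypothesis eq_gen : forall f, farr F (gen f) = farr G (gen f).

Lemma free_functor_eq_ob : fob F =1 fob G.
Proof.
elim=> [|x w IHw]; first by rewrite (f_unitO F) (f_unitO G).
by rewrite (f_tensO F [:: x] w) (f_tensO G [:: x] w) eq_vertex IHw.
Qed.

Lemma free_functor_eq_braid u v :
  farr F (cls (Braid u v)) = farr G (cls (Braid u v)).
Proof.
by rewrite -cls_braid (f_braid F) (f_braid G) !free_functor_eq_ob.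
Qed.

(** The functor laws mention [braid] but not the formal inverse [BraidInv]. Its image is pinned down
    only through preservation of composites and identities. *)
Lemma functor_braidV (H : bsm_functor (free_bsm P) D) u v :
  let b := farr H (cls (Braid u v)) in let b' := farr H (cls (BraidInv u v)) in
  [/\ src b' = tgt b, tgt b' = src b,
      (b' ∘ b)%bsm = idn (src b) & (b ∘ b')%bsm = idn (tgt b)].
Proof.
rewrite /= !(f_src H) !(f_tgt H).
set b : arr (free_bsm P) := cls (Braid u v).
set b' : arr (free_bsm P) := cls (BraidInv u v).
have sb : src b = u ++ v by rewrite [LHS]src_cls.
have tb : tgt b = v ++ u by rewrite [LHS]tgt_cls.
have sb't : src b' = tgt b by rewrite tb [LHS]src_cls.
have tb's : tgt b' = src b by rewrite sb [LHS]tgt_cls.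
split; [by rewrite sb't | by rewrite tb's | |].
- rewrite -(f_comp H) // -(f_idn H) sb; congr (farr H _).
  rewrite [LHS]cls_comp //; apply/cls_eq => //; exact: teq_braidK.
- rewrite -(f_comp H) // -(f_idn H) tb; congr (farr H _).
  rewrite [LHS]cls_comp //; apply/cls_eq => //; exact: teq_braidVK.
Qed.

Lemma free_functor_eq_term t : wf t -> farr F (cls t) = farr G (cls t).
Proof.
elim: t => [f _|u _|g IHg f IHf [wg wf' e]|f IHf g IHg [wf' wg]|u v _|u v _].
- exact: eq_gen.
- by rewrite -cls_idn (f_idn F) (f_idn G) free_functor_eq_ob.
- have e' : @src (free_bsm P) (cls g) = @tgt (free_bsm P) (cls f).
    by rewrite [LHS]src_cls // e [RHS]tgt_cls.
  by rewrite -cls_comp // (f_comp F e') (f_comp G e') IHg // IHf.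
- by rewrite -cls_tens // (f_tensA F) (f_tensA G) IHg // IHf.
- exact: free_functor_eq_braid.
(* Both images of [BraidInv u v] invert the common image of [Braid u v]: the one under [F] serves as
   left inverse, the one under [G] as right inverse. *)
- have [sF _ FK _] := functor_braidV F u v.
  have [sG tG _ GK] := functor_braidV G u v.
  by apply: (inverse_unique (f := farr F (cls (Braid u v)))) => //;
    rewrite free_functor_eq_braid.
Qed.

Lemma free_functor_unique : F = G.
Proof.
apply: bsm_functor_eq free_functor_eq_ob _ => f.
by have [t wt ->] := clsP f; apply: free_functor_eq_term.
Qed.

End FreeFunctorUnique.

(** * Functors between free categories by substitution for the generators *)

Section Subst.
Local Open Scope term_scope.
Variables (P Q : presentation).
Local Notation N := (pgraph P).
Local Notation N' := (pgraph Q).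
Variables (h : vertex N -> vertex N') (phi : edge N -> term N').

(** An edge may go to a composite term, as cup and cap require. A vertex goes to a single vertex, so
    words are transported by [map h], which respects concatenation. *)
Fixpoint subst (t : term N) : term N' :=
  match t with
  | Gen f => phi f
  | Id u => Id (map h u)
  | g ∘ f => subst g ∘ subst f
  | f ⊗ g => subst f ⊗ subst g
  | Braid u v => Braid (map h u) (map h v)
  | BraidInv u v => BraidInv (map h u) (map h v)
  end.

Hypothesis phi_wf : forall f, wf (phi f).
Hypothesis phi_dom : forall f, tdom (phi f) = map h (dom f).
Hypothesis phi_cod : forall f, tcod (phi f) = map h (cod f).

Lemma tdom_subst t : tdom (subst t) = map h (tdom t).
Proof. by elim: t => //= [f -> g ->|u v|u v]; rewrite map_cat. Qed.

Lemma tcod_subst t : tcod (subst t) = map h (tcod t).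
Proof. by elim: t => //= [f -> g ->|u v|u v]; rewrite map_cat. Qed.

Lemma wf_subst t : wf t -> wf (subst t).
Proof.
elim: t => //= [g IHg f IHf [wg wf' e]|f IHf g IHg [/IHf ? /IHg ?]] //.
by split; [exact: IHg | exact: IHf | rewrite tdom_subst tcod_subst e].
Qed.

Hypothesis phi_rel : forall t u, prel t u -> teq (subst t) (subst u).

(** Each structural clause of the congruence is carried to an instance of itself, up to [map_cat];
    only the generating relations call on [phi_rel]. *)
Lemma teq_subst t u : teq t u -> teq (subst t) (subst u).
Proof.
elim=> {t u} /=.
- by move=> t; apply: teq_refl.
- by move=> t u _; apply: teq_sym.
- by move=> t u v _ tu _; apply: teq_trans.
- by move=> *; apply: teq_comp.
- by move=> *; apply: teq_tens.
- exact: phi_rel.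
- by move=> f; rewrite -tcod_subst; apply: teq_idl.
- by move=> f; rewrite -tdom_subst; apply: teq_idr.
- by move=> *; apply: teq_assoc.
- by move=> u v; rewrite map_cat; apply: teq_tens_id.
- by move=> g f k l e1 e2; apply: teq_interchange;
    rewrite tdom_subst tcod_subst ?e1 ?e2.
- by move=> *; apply: teq_tensA.
- by move=> *; apply: teq_unitl.
- by move=> *; apply: teq_unitr.
- by move=> u v; rewrite map_cat; apply: teq_braidK.
- by move=> u v; rewrite map_cat; apply: teq_braidVK.
- by move=> f g; rewrite -!tcod_subst -!tdom_subst; apply: teq_braid_nat.
- by move=> u v w; rewrite map_cat; apply: teq_braid_tensr.
- by move=> u v w; rewrite map_cat; apply: teq_braid_tensl.
Qed.

Definition free_map_arr (f : arr (free_bsm P)) : arr (free_bsm Q) :=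
  cls (subst (rep f)).

(** The representative chosen in [free_map_arr] is immaterial, because substitution respects the
    congruence. *)
Lemma free_map_cls t : wf t -> free_map_arr (cls t) = cls (subst t).
Proof.
move=> wt; apply/cls_eq; [exact/wf_subst/rep_wf | exact: wf_subst |].
by apply: teq_subst; apply: rep_cls.
Qed.

(** Kept transparent so that its values on words and arrows can be computed later. *)
Definition free_map : bsm_functor (free_bsm P) (free_bsm Q).
Proof.
refine (@BsmFunctor (free_bsm P) (free_bsm Q) (map h) free_map_arr
          _ _ _ _ _ _ _ _).
- by move=> f; rewrite [LHS]src_cls ?tdom_subst //; apply/wf_subst/rep_wf.
- by move=> f; rewrite [LHS]tgt_cls ?tcod_subst //; apply/wf_subst/rep_wf.
- by move=> a; rewrite [LHS]free_map_cls.
- move=> g f e; rewrite [LHS]free_map_cls; last by split=> //; apply: rep_wf.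
  rewrite [RHS]cls_comp ?tdom_subst ?tcod_subst //; try exact/wf_subst/rep_wf.
  by congr map.
- by [].
- by move=> a b; rewrite /= map_cat.
- move=> f g; rewrite [LHS]free_map_cls; last by split; apply: rep_wf.
  by rewrite [RHS]cls_tens //; apply/wf_subst/rep_wf.
- by move=> a b; rewrite [LHS]free_map_cls.
Defined.

End Subst.

(** * Whiskering and reassociation of composite terms *)

Section Whisker.
Local Open Scope term_scope.
Variable P : presentation.

(** Interchange applies once [Id u] is expanded to [Id u ∘ Id u]. *)
Lemma teq_whiskerr (g f : term (pgraph P)) u : tdom g = tcod f ->
  teq ((g ∘ f) ⊗ Id u) ((g ⊗ Id u) ∘ (f ⊗ Id u)).
Proof.
move=> e; refine (teq_trans _ (teq_interchange e _)) => //.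
by exact: teq_tens (teq_refl _) (teq_sym (teq_idl (Id u))).
Qed.

Lemma teq_whiskerl (g f : term (pgraph P)) u : tdom g = tcod f ->
  teq (Id u ⊗ (g ∘ f)) ((Id u ⊗ g) ∘ (Id u ⊗ f)).
Proof.
move=> e; refine (teq_trans _ (teq_interchange _ e)) => //.
by exact: teq_tens (teq_sym (teq_idl (Id u))) (teq_refl _).
Qed.

Lemma teq_middle (a b c d m m' : term (pgraph P)) : teq (b ∘ c) (m ∘ m') ->
  teq ((a ∘ b) ∘ (c ∘ d)) ((a ∘ m) ∘ (m' ∘ d)).
Proof.
move=> e; apply: teq_trans (teq_assoc _ _ _) _.
refine (teq_trans _ (teq_sym (teq_assoc _ _ _))).
apply: teq_comp (teq_refl _).
apply: teq_trans (teq_sym (teq_assoc _ _ _)) _.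
refine (teq_trans _ (teq_assoc _ _ _)).
exact: teq_comp (teq_refl _) e.
Qed.

End Whisker.

(** * The tangle algebra carried by a commutative Frobenius algebra *)

Section FrobeniusTangle.
Local Open Scope term_scope.
Variables (M : multigraph) (A : vertex M).
Local Notation teq := (@teq (tcircd_pres M)).
Local Notation one := (@Id (tcircd_graph M) [:: A]).
Local Notation mul := (@Gen (tcircd_graph M) (Mul A)).
Local Notation comul := (@Gen (tcircd_graph M) (Comul A)).
Local Notation n := (@Gen (tcircd_graph M) (Unit A)).
Local Notation e := (@Gen (tcircd_graph M) (Counit A)).
Local Notation tau := (@Braid (tcircd_graph M) [:: A] [:: A]).

Lemma frob_rel_teq t u : frobenius_rel t u -> teq t u.
Proof. exact: (@teq_rel (tcircd_pres M)). Qed.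

Lemma frob_snakel : teq (((e ∘ mul) ⊗ one) ∘ (one ⊗ (comul ∘ n))) one.
Proof.
(* Whiskering exposes [(mul ⊗ one) ∘ (one ⊗ comul)] in the middle, which the Frobenius law turns
   into [comul ∘ mul]. The outer pairs then collapse separately, by the counit and unit laws. *)
apply: teq_trans (teq_comp (teq_whiskerr _ _) (teq_whiskerl _ _)) _ => //.
apply: teq_trans (teq_middle _ _ (frob_rel_teq (frob_frobr A))) _.
refine (teq_trans (teq_comp _ _) (@teq_idl (tcircd_pres M) one)).
- exact/frob_rel_teq/frob_comul_counitl.
- exact/frob_rel_teq/frob_mul_unitr.
Qed.

Lemma frob_snaker : teq ((one ⊗ (e ∘ mul)) ∘ ((comul ∘ n) ⊗ one)) one.
Proof.
apply: teq_trans (teq_comp (teq_whiskerl _ _) (teq_whiskerr _ _)) _ => //.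
apply: teq_trans (teq_middle _ _ (frob_rel_teq (frob_frobl A))) _.
refine (teq_trans (teq_comp _ _) (@teq_idl (tcircd_pres M) one)).
- exact/frob_rel_teq/frob_comul_counitr.
- exact/frob_rel_teq/frob_mul_unitl.
Qed.

Lemma frob_cap_comm : teq ((e ∘ mul) ∘ tau) (e ∘ mul).
Proof.
refine (teq_trans (teq_sym (teq_assoc _ _ _)) _).
exact: teq_comp (teq_refl _) (frob_rel_teq (frob_mul_comm A)).
Qed.

Lemma frob_cup_comm : teq (tau ∘ (comul ∘ n)) (comul ∘ n).
Proof.
refine (teq_trans (teq_assoc _ _ _) _).
exact: teq_comp (frob_rel_teq (frob_comul_comm A)) (teq_refl _).
Qed.

Definition frob_cupcap (f : tangle_edge) : term (tcircd_graph M) :=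
  if f is Cup then comul ∘ n else e ∘ mul.

Lemma frob_cupcap_rel t u : tangle_rel t u ->
  teq (@subst (Presentation tangle_rel_parallel) (tcircd_pres M)
         (fun=> A) frob_cupcap t)
      (@subst (Presentation tangle_rel_parallel) (tcircd_pres M)
         (fun=> A) frob_cupcap u).
Proof.
case; [exact: frob_snakel | exact: frob_snaker | exact: frob_cap_comm
     | exact: frob_cup_comm].
Qed.

Definition frob_functor : bsm_functor Tangle (TCircD M).
Proof.
by refine (@free_map (Presentation tangle_rel_parallel) (tcircd_pres M)
             (fun=> A) frob_cupcap _ _ _ frob_cupcap_rel); case.
Defined.

Lemma frob_functor_gen f : farr frob_functor (gen f) =
  @cls (tcircd_pres M) (frob_cupcap f).
Proof. by rewrite [LHS]free_map_cls; do ?[exact: frob_cupcap_rel | case]. Qed.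

End FrobeniusTangle.

Theorem corollary2p1 (M : multigraph) (A : vertex M) :
  exists! F : bsm_functor Tangle (TCircD M),
    [/\ fob F tangle_X = tcircd_ob A,
        farr F tangle_eta = (Delta A ∘ frob_unit A)%bsm
      & farr F tangle_eps = (frob_counit A ∘ nabla A)%bsm].
Proof.
have eta : farr (frob_functor A) tangle_eta = (Delta A ∘ frob_unit A)%bsm.
  by rewrite [LHS]frob_functor_gen [RHS]cls_comp.
have eps : farr (frob_functor A) tangle_eps = (frob_counit A ∘ nabla A)%bsm.
  by rewrite [LHS]frob_functor_gen [RHS]cls_comp.
exists (frob_functor A); split=> // G [GX Geta Geps].
(* Agreement need only be checked on the single vertex [tt] and the two edges [Cup] and [Cap]. *)
apply: free_functor_unique => [[]|[]]; first exact: esym GX.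
- exact: etrans eta (esym Geta).
- exact: etrans eps (esym Geps).
Qed.
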